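(* Let $R$ be a right coherent ring and $V$ a finitely presented quasi-tilting right $R$-module. Let $\mathrm{Mod}\text{-}R$ and $\mathrm{mod}\text{-}R$ denote the categories of all, respectively finitely presented, right $R$-modules. Consider the following assertions: (1) the associated torsion pair $\mathbf{t}_V:=(\mathrm{Gen}(V),V^\perp)$ in $\mathrm{Mod}\text{-}R$ restricts to $\mathrm{mod}\text{-}R$; (2) $\mathrm{add}(V)$ is a precovering subcategory of $\mathrm{mod}\text{-}R$; (3) $\mathrm{Hom}_R(V,X)$ is a finitely presented right $\mathrm{End}_R(V_R)$-module, for all $X\in\mathrm{mod}\text{-}R$; (4) $\mathrm{End}_R(V_R)$ is a right coherent ring. The implications (1)$\Leftrightarrow$(2)$\Leftrightarrow$(3) hold true and when, in addition, $V$ is finendo, the implication (3)$\Rightarrow$(4) also holds. When $V$ is a (classical) tilting $R$-module, then all assertions are equivalent.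
   Context: Rings are unital and associative. In $\mathrm{Mod}\text{-}R$: $\mathrm{Add}(V)$ (resp. $\mathrm{add}(V)$) is the class of direct summands of coproducts (resp. finite coproducts) of copies of $V$; $\mathrm{Gen}(V)$ is the class of quotients of objects of $\mathrm{Add}(V)$; $\mathrm{Pres}(V)$ is the class of cokernels of morphisms in $\mathrm{Add}(V)$; $\overline{\mathrm{Gen}}(V)$ is the class of submodules of modules in $\mathrm{Gen}(V)$; $V^\perp=\{M:\mathrm{Hom}_R(V,M)=0\}$, $V^{\perp_1}=\{M:\mathrm{Ext}^1_R(V,M)=0\}$. A right $R$-module $V$ is quasi-tilting if $\mathrm{Gen}(V)$ is a torsion class and $\mathrm{Gen}(V)=\mathrm{Pres}(V)=\overline{\mathrm{Gen}}(V)\cap V^{\perp_1}$ (in $\mathrm{Mod}\text{-}R$). It is finendo if it is finitely generated as a left $\mathrm{End}_R(V)$-module. A torsion pair $(\mathcal{T},\mathcal{F})$ in $\mathrm{Mod}\text{-}R$ restricts to $\mathrm{mod}\text{-}R$ if $(\mathcal{T}\cap\mathrm{mod}\text{-}R,\mathcal{F}\cap\mathrm{mod}\text{-}R)$ is a torsion pair in the Abelian category $\mathrm{mod}\text{-}R$. A subcategory $\mathcal{X}$ of $\mathrm{mod}\text{-}R$ is precovering if every $A\in\mathrm{mod}\text{-}R$ admits a morphism $X_A\to A$ with $X_A\in\mathcal{X}$ such that $\mathrm{Hom}_R(X,X_A)\to\mathrm{Hom}_R(X,A)$ is surjective for all $X\in\mathcal{X}$. A classical tilting right $R$-module is a right $R$-module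 $V$ such that: there is an exact sequence $0\to P_1\to P_0\to V\to 0$ with $P_0,P_1$ finitely generated projective; $\mathrm{Ext}^1_R(V,V)=0$; and there is an exact sequence $0\to R\to V_0\to V_1\to 0$ with $V_0,V_1\in\mathrm{add}(V)$. *)

(* Defs.v *)
From HB Require Import structures.
From mathcomp Require Import all_boot all_algebra.
From mathcomp Require Import boolp classical_sets functions cardinality.

Set Implicit Arguments.
Unset Strict Implicit.
Unset Printing Implicit Defensive.

Import GRing.Theory.
Local Open Scope ring_scope.

(** [R : pzRingType] is an arbitrary unital associative ring (the zero ring is
    allowed, which matters because [End 0] is the zero ring).  MathComp modules
    are left modules; a right [R]-module is a left module over the converse
    ring [R^c], and its scalar action [r *: x] is to be read as [x r].  Notions
    that do not depend on the side are stated over a ring [S], and used with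
    [S := R^c].  A class of modules (full subcategory) is a predicate on
    [lmodType S]. *)
Notation rmodType R := (lmodType R^c).

(** * Linear maps as modules *)

Section Hom.
Variables (S : pzRingType) (V X : lmodType S).

Definition lhom : Type := {linear V -> X}.

HB.instance Definition _ := gen_eqMixin lhom.
HB.instance Definition _ := gen_choiceMixin lhom.

Lemma lhomP (f g : lhom) : (f : V -> X) =1 g -> f = g.
Proof.
case: f g => [f [[f1] [f2]]] [g [[g1] [g2]]] /= fg.
have {}fg : f = g by apply/funext.
subst g; congr (GRing.Linear.Pack (GRing.Linear.Class _ _));
  congr (_ _); exact: Prop_irrelevance.
Qed.

Definition lhom_add (f g : lhom) : lhom := f \+ g.
Definition lhom_opp (f : lhom) : lhom := \- f.
Definition lhom_zero : lhom := \0.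

Lemma lhom_addA : associative lhom_add.
Proof. by move=> f g h; apply: lhomP => x /=; rewrite addrA. Qed.
Lemma lhom_addC : commutative lhom_add.
Proof. by move=> f g; apply: lhomP => x /=; rewrite addrC. Qed.
Lemma lhom_add0 : left_id lhom_zero lhom_add.
Proof. by move=> f; apply: lhomP => x /=; rewrite add0r. Qed.
Lemma lhom_addN : left_inverse lhom_zero lhom_opp lhom_add.
Proof. by move=> f; apply: lhomP => x /=; rewrite addNr. Qed.

HB.instance Definition _ :=
  GRing.isZmodule.Build lhom lhom_addA lhom_addC lhom_add0 lhom_addN.

End Hom.

(** The product [f * g] of the endomorphism ring is the composite [f \o g]. *)
Section Endo.
Variables (S : pzRingType) (V : lmodType S).

Definition endo : Type := lhom V V.

HB.instance Definition _ := GRing.Zmodule.on endo.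

Definition endo_one : endo := (idfun : {linear V -> V}).
Definition endo_mul (f g : endo) : endo := ((f : lhom V V) \o (g : lhom V V)).

Lemma endo_mulA : associative endo_mul.
Proof. by move=> f g h; apply: lhomP. Qed.
Lemma endo_mul1 : left_id endo_one endo_mul.
Proof. by move=> f; apply: lhomP. Qed.
Lemma endo_1mul : right_id endo_one endo_mul.
Proof. by move=> f; apply: lhomP. Qed.
Lemma endo_mulDl : left_distributive endo_mul +%R.
Proof. by move=> f g h; apply: lhomP. Qed.
Lemma endo_mulDr : right_distributive endo_mul +%R.
Proof. by move=> f g h; apply: lhomP => x /=; rewrite raddfD. Qed.

HB.instance Definition _ :=
  GRing.Zmodule_isPzRing.Build endo
    endo_mulA endo_mul1 endo_1mul endo_mulDl endo_mulDr.

End Endo.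

(** [Hom(V, X)] is a right [End V]-module by precomposition. *)
Section HomModule.
Variables (S : pzRingType) (V X : lmodType S).

Definition lhom_scale (f : (endo V)^c) (h : lhom V X) : lhom V X :=
  h \o (f : lhom V V).

Lemma lhom_scaleA f g h : lhom_scale f (lhom_scale g h) = lhom_scale (f * g) h.
Proof. by apply: lhomP. Qed.
Lemma lhom_scale1 : left_id 1 lhom_scale.
Proof. by move=> h; apply: lhomP. Qed.
Lemma lhom_scaleDr : right_distributive lhom_scale +%R.
Proof. by move=> f g h; apply: lhomP. Qed.
Lemma lhom_scaleDl h : {morph lhom_scale^~ h : f g / f + g}.
Proof. by move=> f g; apply: lhomP => x /=; rewrite raddfD. Qed.

HB.instance Definition _ :=
  GRing.Zmodule_isLmodule.Build (endo V)^c (lhom V X)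
    lhom_scaleA lhom_scale1 lhom_scaleDr lhom_scaleDl.

End HomModule.

(** The group [V] as a left [End V]-module by evaluation. *)
Section EvalModule.
Variables (S : pzRingType) (V : lmodType S).

Definition evmod : Type := V.

HB.instance Definition _ := GRing.Zmodule.on evmod.

Definition ev_scale (f : endo V) (x : evmod) : evmod := (f : lhom V V) x.

Lemma ev_scaleA f g x : ev_scale f (ev_scale g x) = ev_scale (f * g) x.
Proof. by []. Qed.
Lemma ev_scale1 : left_id 1 ev_scale.
Proof. by []. Qed.
Lemma ev_scaleDr : right_distributive ev_scale +%R.
Proof. by move=> f x y; rewrite /ev_scale raddfD. Qed.
Lemma ev_scaleDl x : {morph ev_scale^~ x : f g / f + g}.
Proof. by []. Qed.

HB.instance Definition _ :=
  GRing.Zmodule_isLmodule.Build (endo V) evmod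
    ev_scaleA ev_scale1 ev_scaleDr ev_scaleDl.

End EvalModule.

(** * Coproducts of copies of a module *)

(** The coproduct of copies of [V] indexed by [I], as the submodule of the
    power [I -> V] of finitely supported families. *)
Section Copower.
Variables (S : pzRingType) (I : Type) (V : lmodType S).

Definition finsupp : {pred (I -> V)} :=
  fun f => `[< finite_set [set i | f i != 0]%classic >].

Lemma finsupp_submod : GRing.submod_closed finsupp.
Proof.
split=> [|a f g /asboolP ff /asboolP fg]; apply/asboolP.
  suff -> : [set i | (0 : I -> V) i != 0]%classic = set0 by exact: finite_set0.
  by apply/seteqP; split=> // i /=; rewrite eqxx.
apply: (@sub_finite_set _ _
  ([set i | f i != 0] `|` [set i | g i != 0])%classic); last first.
  by rewrite finite_setU.
move=> i /=; apply: contraPP => /not_orP[/negP/negPn/eqP fi /negP/negPn/eqP gi].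
by apply/negP/negPn/eqP; rewrite -[LHS]/(a *: f i + g i) fi gi scaler0 addr0.
Qed.

HB.instance Definition _ :=
  GRing.isSubmodClosed.Build S (I -> V) finsupp finsupp_submod.

Record copower : Type :=
  Copower { copower_val : I -> V; _ : copower_val \in finsupp }.

HB.instance Definition _ := [isSub for copower_val].
HB.instance Definition _ := [Choice of copower by <:].
HB.instance Definition _ := [SubChoice_isSubZmodule of copower by <:].
HB.instance Definition _ := [SubZmodule_isSubLmodule of copower by <:].

End Copower.

Section Modules.
Variable S : pzRingType.
Implicit Types (A B C E M V X : lmodType S).
Implicit Types (T F U : lmodType S -> Prop).

(** * Exact sequences, finiteness, projectivity *)

Definition surj A B (f : A -> B) : Prop := forall b, exists a, f a = b.

Definition exact_at A B C (f : {linear A -> B}) (g : {linear B -> C}) : Prop :=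
  forall b, g b = 0 <-> exists a, f a = b.

Definition short_exact A B C (f : {linear A -> B}) (g : {linear B -> C}) :
  Prop := [/\ injective f, exact_at f g & surj g].

Definition fin_gen M : Prop :=
  exists n (x : 'I_n -> M),
    forall m, exists a : 'I_n -> S, m = \sum_(i < n) a i *: x i.

Definition fin_pres M : Prop :=
  exists (m n : nat) (f : {linear 'rV[S]_m -> 'rV[S]_n})
    (g : {linear 'rV[S]_n -> M}), exact_at f g /\ surj g.

Definition projective (P : lmodType S) : Prop :=
  forall A B (g : {linear A -> B}) (f : {linear P -> B}), surj g ->
    exists h : {linear P -> A}, forall x, g (h x) = f x.

(** * Subcategories attached to a module *)

Definition summand M C : Prop :=
  exists (i : {linear M -> C}) (p : {linear C -> M}), cancel i p.

Definition AddCl V M : Prop := exists I : Type, summand M (copower I V).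

Definition addCl V M : Prop := exists n : nat, summand M (copower 'I_n V).

Definition Gen V M : Prop :=
  exists A (f : {linear A -> M}), AddCl V A /\ surj f.

Definition Pres V M : Prop :=
  exists A B (f : {linear A -> B}) (g : {linear B -> M}),
    [/\ AddCl V A, AddCl V B, exact_at f g & surj g].

Definition subGen V M : Prop :=
  exists A (f : {linear M -> A}), Gen V A /\ injective f.

Definition perp V M : Prop := forall (f : {linear V -> M}) x, f x = 0.

(** Vanishing of the Yoneda group [Ext^1 (V, M)]: every extension of [V] by [M]
    is equivalent to the trivial extension [M * V]. *)
Definition ext1_zero V M : Prop :=
  forall E (i : {linear M -> E}) (p : {linear E -> V}), short_exact i p ->
    exists h : {linear E -> (M * V)%type},
      (forall m, h (i m) = (m, 0)) /\ (forall e, (h e).2 = p e).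

(** * Torsion pairs *)

(** A torsion pair in the full subcategory [U].  Exactness is that of modules:
    this is the exactness of [U] when [U] is an abelian subcategory whose
    inclusion is exact, as for all modules, or for finitely presented modules
    over a coherent ring. *)
Definition torsion_pair_in U T F : Prop :=
  [/\ forall M, T M -> U M,
      forall M, F M -> U M,
      forall A B (f : {linear A -> B}), T A -> F B -> forall x, f x = 0
    & forall M, U M -> exists A B (i : {linear A -> M}) (p : {linear M -> B}),
        [/\ T A, F B & short_exact i p]].

Definition torsion_pair T F : Prop := torsion_pair_in (fun _ => True) T F.

Definition torsion_class T : Prop := exists F, torsion_pair T F.

Definition restricts_to_fp T F : Prop :=
  torsion_pair_in fin_pres (fun M => T M /\ fin_pres M)
                           (fun M => F M /\ fin_pres M).

Definition quasi_tilting V : Prop :=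
  [/\ torsion_class (Gen V),
      forall M, Gen V M <-> Pres V M
    & forall M, Gen V M <-> subGen V M /\ ext1_zero V M].

Definition precovering_in_fp U : Prop :=
  (forall M, U M -> fin_pres M) /\
  forall A, fin_pres A ->
    exists X (f : {linear X -> A}), U X /\
      forall Y, U Y -> forall g : {linear Y -> A},
        exists h : {linear Y -> X}, forall y, f (h y) = g y.

Definition classical_tilting V : Prop :=
  [/\ exists (P1 P0 : lmodType S) (f : {linear P1 -> P0}) (g : {linear P0 -> V}),
        [/\ projective P1 /\ fin_gen P1, projective P0 /\ fin_gen P0
          & short_exact f g],
      ext1_zero V V
    & exists (V0 V1 : lmodType S) (f : {linear S^o -> V0}) (g : {linear V0 -> V1}),
        [/\ addCl V V0, addCl V V1 & short_exact f g]].

End Modules.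

(** A right ideal is a submodule of the regular right module, represented here
    by a module [I] with an injective linear map into it. *)
Definition right_coherent (R : pzRingType) : Prop :=
  forall (I : rmodType R) (j : {linear I -> (R^c)^o}),
    injective j -> fin_gen I -> fin_pres I.

Definition finendo (S : pzRingType) (V : lmodType S) : Prop :=
  fin_gen (evmod V : lmodType (endo V)).

(* Main.v *)
(** Write [E] for [End V].  The pivotal condition, equivalent to each of (1),
    (2), (3), is that for every finitely presented [X] the right [E]-module
    [Hom (V, X)] is finitely generated, i.e. that all maps [V -> X] factor
    through a single map [V^n -> X].

    It holds for every finitely presented [T] in [Gen V = Pres V].  Present [T]
    as a quotient of a coproduct [V^(J)] whose kernel is a trace of [V].  As
    [T] is finitely presented, a map [V^m0 -> T] onto [T] has a finitely
    generated kernel, whose image in [V^(J)] therefore lies in the image of a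
    single [V^l -> V^(J)] killed by [V^(J) -> T].  Inside a finite [V^m] this
    image is a module [D] in [Gen V], and [V^m / D -> T] has a section; as
    [Ext^1 (V, D) = 0], all maps [V -> T] lift to [V^m].  This gives
    (1) => (2), and conversely the image of a precover of [X] is the torsion
    part of [X].  Right coherence of [R] makes kernels finitely presented,
    whence (2) => (3) and (3) => (4).

    For (4) => (3), let [0 -> R -> V0 -> V1 -> 0] be exact with [V0], [V1] in
    [add V].  Pushing [0 -> R^n -> V0^n -> V1^n -> 0] out along a presentation
    [R^n -> X] embeds [X] in a finitely presented [X'] of [Gen V] with quotient
    [V1^n].  Then [Hom (V, X)] is the kernel of a map from the finitely
    generated module [Hom (V, X')] to the projective module [Hom (V, V1^n)],
    hence is finitely generated by coherence of [E]. *)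

From HB Require Import structures.
From mathcomp Require Import all_boot all_algebra.
From mathcomp Require Import boolp classical_sets functions cardinality.
Require Import Defs.

Set Implicit Arguments.
Unset Strict Implicit.
Unset Printing Implicit Defensive.

Import GRing.Theory.
Local Open Scope ring_scope.
Local Open Scope quotient_scope.

(* The proof [lin_f] is a phantom argument on which the canonical linear
   structure is keyed; [submod_pred] below works in the same way. *)
Definition linear_fun (S : pzRingType) (A B : lmodType S) (f : A -> B)
  (lin_f : linear f) : A -> B := f.

HB.instance Definition _ (S : pzRingType) (A B : lmodType S) (f : A -> B)
    (lin_f : linear f) :=
  GRing.isLinear.Build S A B *:%R (linear_fun lin_f) lin_f.

Definition mklin (S : pzRingType) (A B : lmodType S) (f : A -> B)
  (lin_f : linear f) : {linear A -> B} := linear_fun lin_f.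

(** * Submodules and quotients *)

Section SubQuotient.
Variables (S : pzRingType) (M : lmodType S).
Variables (Q : {pred M}) (closedQ : GRing.submod_closed Q).

Definition submod_pred of GRing.submod_closed Q : {pred M} := Q.

HB.instance Definition _ :=
  GRing.isSubmodClosed.Build S M (submod_pred closedQ) closedQ.

Local Notation P := (submod_pred closedQ).

Record submodule : Type :=
  Submodule { submodule_val : M; _ : submodule_val \in P }.

HB.instance Definition _ := [isSub for submodule_val].
HB.instance Definition _ := [Choice of submodule by <:].
HB.instance Definition _ := [SubChoice_isSubZmodule of submodule by <:].
HB.instance Definition _ := [SubZmodule_isSubLmodule of submodule by <:].

Definition quotmod : Type := Quotient.quot P.

HB.instance Definition _ := GRing.Zmodule.on quotmod.

Definition quotmod_pi (x : M) : quotmod := \pi_(Quotient.quot P) x.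

Lemma quotmod_pi_eq x y : quotmod_pi x = quotmod_pi y <-> x - y \in P.
Proof. by rewrite Quotient.idealrBE; split=> /eqP. Qed.

Lemma quotmod_pi_surj q : exists x, quotmod_pi x = q.
Proof. by exists (repr q); rewrite /quotmod_pi reprK. Qed.

Lemma quotmod_piD : {morph quotmod_pi : x y / x + y}.
Proof. by move=> x y; rewrite /quotmod_pi !piE. Qed.

Definition quotmod_scale (a : S) (q : quotmod) : quotmod :=
  quotmod_pi (a *: repr (q : Quotient.quot P)).

Lemma quotmod_piZ a x : quotmod_scale a (quotmod_pi x) = quotmod_pi (a *: x).
Proof.
apply/quotmod_pi_eq; rewrite -scalerBr rpredZ //.
by apply/quotmod_pi_eq; rewrite /quotmod_pi reprK.
Qed.

Lemma quotmod_scaleA a b q :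
  quotmod_scale a (quotmod_scale b q) = quotmod_scale (a * b) q.
Proof. by have [x <-] := quotmod_pi_surj q; rewrite !quotmod_piZ scalerA. Qed.
Lemma quotmod_scale1 : left_id 1 quotmod_scale.
Proof. by move=> q; have [x <-] := quotmod_pi_surj q;
  rewrite quotmod_piZ scale1r. Qed.
Lemma quotmod_scaleDr : right_distributive quotmod_scale +%R.
Proof.
move=> a p q; have [x <-] := quotmod_pi_surj p;
  have [y <-] := quotmod_pi_surj q.
by rewrite -quotmod_piD !quotmod_piZ scalerDr quotmod_piD.
Qed.
Lemma quotmod_scaleDl q : {morph quotmod_scale^~ q : a b / a + b}.
Proof.
move=> a b; have [x <-] := quotmod_pi_surj q.
by rewrite !quotmod_piZ scalerDl quotmod_piD.
Qed.

HB.instance Definition _ := GRing.Zmodule_isLmodule.Build S quotmod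
  quotmod_scaleA quotmod_scale1 quotmod_scaleDr quotmod_scaleDl.

Lemma quotmod_pi_linear : linear quotmod_pi.
Proof. by move=> a x y; rewrite quotmod_piD -quotmod_piZ. Qed.

End SubQuotient.

(** * Kernels, images, factorizations, pullbacks, and lifting against vanishing Ext *)

Section Universal.
Variable S : pzRingType.
Implicit Types (A B C D E I K M N V W X : lmodType S).

Lemma ker_closed A B (f : {linear A -> B}) :
  GRing.submod_closed [pred x | f x == 0].
Proof.
by split=> [|a x y]; rewrite !inE ?linear0 // linearP => /eqP-> /eqP->;
  rewrite scaler0 addr0.
Qed.

Definition image_pred A B (f : A -> B) : {pred B} :=
  fun y => `[< exists x, f x = y >].

Lemma image_closed A B (f : {linear A -> B}) :
  GRing.submod_closed (image_pred f).
Proof.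
split=> [|a _ _ /asboolP[x <-] /asboolP[y <-]]; apply/asboolP;
  first by exists 0; rewrite linear0.
by exists (a *: x + y); rewrite linearP.
Qed.

Lemma submodule_ex M (P : {pred M}) : GRing.submod_closed P ->
  exists K (i : {linear K -> M}),
    injective i /\ forall x, x \in P <-> exists k, i k = x.
Proof.
move=> clP.
exists (submodule clP), (val : submodule clP -> M); split; first exact: val_inj.
by move=> x; split=> [Px|[k <-]];
  [exists (Submodule (closedQ := clP) Px)|exact: (valP k)].
Qed.

Lemma quotient_ex M (P : {pred M}) : GRing.submod_closed P ->
  exists C (q : {linear M -> C}), surj q /\ forall x, q x = 0 <-> x \in P.
Proof.
move=> clP.
pose q := mklin (quotmod_pi_linear clP).
exists (quotmod clP), q; split=> [|x]; first exact: quotmod_pi_surj.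
rewrite -(linear0 q).
by rewrite -[x in x \in P]subr0; exact: quotmod_pi_eq.
Qed.

Lemma kernel_ex A B (f : {linear A -> B}) :
  exists K (i : {linear K -> A}), injective i /\ exact_at i f.
Proof.
have [K [i [inj_i iP]]] := submodule_ex (ker_closed f).
by exists K, i; split=> // x; rewrite -iP inE; split=> /eqP.
Qed.

Lemma image_ex A B (f : {linear A -> B}) :
  exists D (e : {linear A -> D}) (j : {linear D -> B}),
    [/\ surj e, injective j & forall x, j (e x) = f x].
Proof.
have [D [j [inj_j jP]]] := submodule_ex (image_closed f).
have je x : exists d, j d = f x by apply/jP/asboolP; exists x.
have [e eP] := choice je.
have lin_e : linear e by move=> a x y; apply: inj_j;
  rewrite linearP !eP linearP.
exists D, (mklin lin_e), j; split=> // d.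
have /jP/asboolP [x fx] : exists d', j d' = j d by exists d.
by exists x; apply: inj_j; rewrite eP.
Qed.

Lemma cokernel_ex A B (f : {linear A -> B}) :
  exists C (q : {linear B -> C}), exact_at f q /\ surj q.
Proof.
have [C [q [sq qP]]] := quotient_ex (image_closed f).
by exists C, q; split=> // b; rewrite qP; split=> /asboolP.
Qed.

(** A set-theoretic section [s] of [g] is chosen; [h \o s] is linear because [h] is constant on the
    fibres of [g]. *)
Lemma factor_surj A B C (g : {linear A -> B}) (h : {linear A -> C}) : surj g ->
  (forall x, g x = 0 -> h x = 0) ->
  exists k : {linear B -> C}, forall x, k (g x) = h x.
Proof.
move=> sg gh; have [s sP] := choice sg.
have hE x y : g x = g y -> h x = h y.
  by move=> /eqP; rewrite -subr_eq0 -linearB => /eqP/gh/eqP;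
    rewrite linearB subr_eq0 => /eqP.
have lin_k : linear (h \o s).
  by move=> a b c; rewrite /= -linearP; apply: hE; rewrite linearP !sP.
by exists (mklin lin_k) => x; apply: hE; rewrite sP.
Qed.

Lemma factor_inj A B C (i : {linear B -> C}) (h : {linear A -> C}) :
  injective i ->
  (forall x, exists y, i y = h x) ->
  exists k : {linear A -> B}, forall x, i (k x) = h x.
Proof.
move=> inj_i ih; have [k kP] := choice ih.
have lin_k : linear k by move=> a x y; apply: inj_i;
  rewrite linearP !kP linearP.
by exists (mklin lin_k).
Qed.

Lemma pullback_ex A B C (f : {linear A -> C}) (g : {linear B -> C}) :
  exists E (p : {linear E -> A}) (q : {linear E -> B}),
    [/\ forall e, f (p e) = g (q e),
        forall a b, f a = g b -> exists e, p e = a /\ q e = b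
      & forall X (h : {linear X -> A}) (k : {linear X -> B}),
          (forall x, f (h x) = g (k x)) ->
          exists l : {linear X -> E}, forall x, p (l x) = h x /\ q (l x) = k x]
    /\ (forall e, p e = 0 -> q e = 0 -> e = 0).
Proof.
(* The pullback is the kernel of this difference map on the product. *)
have lin_d : linear (fun x : (A * B)%type => f x.1 - g x.2).
  by move=> a x y; rewrite /= [f _]linearP [g _]linearP opprD addrACA scalerBr.
have [E [i [inj_i iP]]] := kernel_ex (mklin lin_d).
have lift a b : f a = g b -> exists e, i e = (a, b).
  by move=> ab; apply/iP; rewrite /= /linear_fun /= ab subrr.
exists E, (fst \o i), (snd \o i); split;
  first split=> [e|a b /lift[e ie]|X h k hk].
- by apply/eqP; rewrite -subr_eq0; apply/eqP/iP; exists e.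
- by exists e; rewrite /= ie.
- have lin_hk : linear (fun x => (h x, k x)).
    by move=> a x y; rewrite [h _]linearP [k _]linearP.
  have [l lP] := factor_inj (h := mklin lin_hk) inj_i
    (fun x => lift _ _ (hk x)).
  by exists l => x; rewrite /= lP.
move=> e /=; case E1 : (i e) => [a b] /= a0 b0; apply: inj_i.
by rewrite E1 a0 b0 linear0.
Qed.

(** Pulling the extension of [C] by [D] back along [g] gives an extension of [V] by [D], which
    splits; a section of it followed by the projection to [W] lifts [g]. *)
Lemma ext1_lift V D W C (j : {linear D -> W}) (c : {linear W -> C}) :
  ext1_zero V D -> short_exact j c ->
  forall g : {linear V -> C},
    exists h : {linear V -> W}, forall v, c (h v) = g v.
Proof.
move=> extD [inj_j jc sc] g.
have [E [p [q [[cp lift univ] inj_pq]]]] := pullback_ex c g.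
have [|i iP] := univ D j (\0 : {linear D -> V}).
  by move=> d; rewrite linear0; apply/jc; exists d.
have siq : short_exact i q.
  split=> [||v].
  - by move=> d d' ii; apply: inj_j; rewrite -!(proj1 (iP _)) ii.
  - move=> e; split=> [qe|[d <-]]; last by case: (iP d).
    have /jc[d jd] : c (p e) = 0 by rewrite cp qe linear0.
    exists d; apply/eqP; rewrite -subr_eq0; apply/eqP/inj_pq; rewrite linearB.
      by rewrite (proj1 (iP d)) jd subrr.
    by rewrite (proj2 (iP d)) qe subrr.
  - by have [w cw] := sc (g v); have [e [_ <-]] := lift _ _ cw; exists e.
have [h [hi hq]] := extD E i q siq.
(* The first component of [h] retracts [i], so this map kills the image of [i] and descends along
   [q] to [V]. *)
have lin_k : linear (fun e => p e - j (h e).1).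
  by move=> a x y; rewrite [p _]linearP [h _]linearP [j _]linearP opprD addrACA
    scalerBr.
have [|k kP] := factor_surj (g := q) (h := mklin lin_k)
  (let: And3 _ _ s := siq in s).
  move=> e /(let: And3 _ ex _ := siq in ex)[d <-].
  by rewrite /= /linear_fun hi (proj1 (iP d)) subrr.
exists k => v; have [e <-] : exists e, q e = v by case: siq => _ _; apply.
rewrite kP /= /linear_fun linearB cp.
by have /jc -> : exists d, j d = j (h e).1; [exists (h e).1|rewrite subr0].
Qed.

End Universal.

(** * Finite generation, finite presentation and coherence *)

Section Finiteness.
Variable S : pzRingType.
Implicit Types (A B C D E I K M N V W X : lmodType S).

Lemma lincomb_linear M n (x : 'I_n -> M) :
  linear (fun u : 'rV[S]_n => \sum_i u 0 i *: x i).
Proof.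
move=> a u v; rewrite scaler_sumr -big_split; apply: eq_bigr => i _ /=.
by rewrite !mxE scalerDl scalerA.
Qed.

Definition lincomb M n (x : 'I_n -> M) := mklin (lincomb_linear x).

Lemma lincombE M n (x : 'I_n -> M) u : lincomb x u = \sum_i u 0 i *: x i.
Proof. by []. Qed.

Lemma linear_rowE M n (g : {linear 'rV[S]_n -> M}) u :
  g u = lincomb (fun i => g (delta_mx 0 i)) u.
Proof.
by rewrite lincombE {1}[u]row_sum_delta linear_sum; apply: eq_bigr => i _;
  rewrite linearZ.
Qed.

(** Finitely generated submodules are kept as predicates, so that kernels and images need not be
    built as modules. *)
Definition fg_pred M (P : M -> Prop) : Prop :=
  exists n (g : {linear 'rV[S]_n -> M}), forall x, P x <-> exists u, g u = x.

Lemma fg_pred_ext M (P Q : M -> Prop) :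
  (forall x, P x <-> Q x) -> fg_pred P -> fg_pred Q.
Proof. by move=> PQ [n [g gP]]; exists n, g => x; rewrite -PQ. Qed.

Lemma fin_genP M : fin_gen M <-> exists n (g : {linear 'rV[S]_n -> M}), surj g.
Proof.
split=> [[n [x xP]]|[n [g sg]]].
  exists n, (lincomb x) => m; have [a ->] := xP m.
  by exists (\row_i a i); rewrite lincombE; apply: eq_bigr => i _; rewrite mxE.
exists n, (fun i => g (delta_mx 0 i)) => m; have [u <-] := sg m.
by exists (fun i => u 0 i); rewrite linear_rowE.
Qed.

Lemma fin_presP M :
  fin_pres M <-> exists n (g : {linear 'rV[S]_n -> M}), surj g /\
    fg_pred (fun u => g u = 0).
Proof.
split=> [[m [n [f [g [fg sg]]]]]|[n [g [sg [m [f fg]]]]]].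
  by exists n, g; split=> //; exists m, f.
by exists m, n, f, g.
Qed.

Lemma fin_pres_gen M : fin_pres M -> fin_gen M.
Proof. by move=> /fin_presP[n [g [sg _]]]; apply/fin_genP; exists n, g. Qed.

Lemma free_lift A M n (p : {linear A -> M}) (f : {linear 'rV[S]_n -> M}) :
  (forall u, exists a, p a = f u) ->
  exists g : {linear 'rV[S]_n -> A}, forall u, p (g u) = f u.
Proof.
move=> pf; have [x xP] := choice (fun i => pf (delta_mx 0 i)).
exists (lincomb x) => u; rewrite [RHS]linear_rowE !lincombE linear_sum.
by apply: eq_bigr => i _; rewrite linearZ /= xP.
Qed.

Lemma row_pair_ex M m n (f : {linear 'rV[S]_m -> M})
  (g : {linear 'rV[S]_n -> M}) :
  exists h : {linear 'rV[S]_(m + n) -> M}, forall u v,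
    h (row_mx u v) = f u + g v.
Proof.
have lin_h : linear (fun w : 'rV[S]_(m + n) => f (lsubmx w) + g (rsubmx w)).
  by move=> a x y; rewrite !linearP /= scalerDr addrACA.
by exists (mklin lin_h) => u v /=; rewrite /linear_fun row_mxKl row_mxKr.
Qed.

Lemma fin_gen_surj A M (f : {linear A -> M}) : surj f -> fin_gen A -> fin_gen M.
Proof.
move=> sf /fin_genP[n [g sg]]; apply/fin_genP; exists n, (f \o g) => m.
by have [a <-] := sf m; have [u <-] := sg a; exists u.
Qed.

(* Schanuel: finite presentation does not depend on the chosen presentation. *)
Lemma fin_pres_ker A M (g : {linear A -> M}) :
  fin_pres M -> fin_gen A -> surj g -> fg_pred (fun a => g a = 0).
Proof.
move=> /fin_presP[n [p [sp [m [z zP]]]]] /fin_genP[k [q sq]] sg.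
have [p' p'P] := free_lift (fun u => sg (p u)).
have [r rP] := free_lift (fun u => sp ((g \o q) u)).
have lin_d : linear (fun u => q u - p' (r u)).
  by move=> a x y; rewrite [q _]linearP [r _]linearP [p' _]linearP opprD
    addrACA scalerBr.
(* The kernel of [g] is generated by the corrections [q u - p' (r u)] together with the lifted
   relations [p' (z v)]. *)
have [h hP] := row_pair_ex (mklin lin_d) (p' \o z).
exists (k + m)%N, h => x; split=> [gx|[w <-]].
  have [u qu] := sq x; have /zP[v zv] : p (r u) = 0 by rewrite rP /= qu.
  by exists (row_mx u v); rewrite hP /= zv /linear_fun qu subrK.
rewrite -[w]hsubmxK hP /= /linear_fun linearD linearB !p'P rP subrr add0r.
by apply/zP; exists (rsubmx w).
Qed.

(** In the free cover of [A], the preimage of the kernel of [g] is generated by lifts of the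
    generators of that kernel and by the relations of [A]. *)
Lemma fin_pres_quot A M (g : {linear A -> M}) :
  fin_pres A -> surj g -> fg_pred (fun a => g a = 0) -> fin_pres M.
Proof.
move=> /fin_presP[n [p [sp [m [z zP]]]]] sg [k [w wP]].
have [w' w'P] := free_lift (fun u => sp (w u)).
have [h hP] := row_pair_ex w' z.
apply/fin_presP; exists n, (g \o p); split=> [x|].
  by have [a <-] := sg x; have [u <-] := sp a; exists u.
exists (k + m)%N, h => x; split=> /= [/wP[u wu]|[v <-]].
  have /zP[v zv] : p (x - w' u) = 0 by rewrite linearB w'P wu subrr.
  by exists (row_mx u v); rewrite hP zv addrC subrK.
rewrite -[v]hsubmxK hP linearD.
have /zP -> : exists y, z y = z (rsubmx v) by exists (rsubmx v).
by rewrite addr0 w'P; apply/wP; exists (lsubmx v).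
Qed.

(** Coherence without finite generation of [M] itself: equivalently, every finitely generated
    submodule of [M] is finitely presented. *)
Definition coherent_mod M : Prop :=
  forall n (f : {linear 'rV[S]_n -> M}), fg_pred (fun u => f u = 0).

Lemma coherent_mod_inj A B (i : {linear A -> B}) :
  injective i -> coherent_mod B -> coherent_mod A.
Proof.
move=> inj_i cB n f; apply: fg_pred_ext (cB n (i \o f)) => u /=.
by split=> [|->]; rewrite ?linear0 // -{1}[0 in X in X -> _](linear0 i) =>
  /inj_i.
Qed.

(** The relations of the first component are finitely generated; the second component is then
    restricted to them. *)
Lemma coherent_mod_prod A B :
  coherent_mod A -> coherent_mod B -> coherent_mod (A * B)%type.
Proof.
move=> cA cB n f; have [k [z zP]] := cA n (fst \o f).
have [m [y yP]] := cB k (snd \o f \o z).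
exists m, (z \o y) => u; split=> [fu|[v <-]].
  have /zP[v zv] : (fst \o f) u = 0 by rewrite /= fu.
  have /yP[w yw] : (snd \o f \o z) v = 0 by rewrite /= zv fu.
  by exists w; rewrite /= yw.
have /zP /= f1 : exists x, z x = z (y v) by exists (y v).
have /yP /= f2 : exists x, y x = y v by exists v.
by rewrite /= [LHS]surjective_pairing f1 f2.
Qed.

Lemma coherent_mod_power M n : coherent_mod M -> coherent_mod ('I_n -> M).
Proof.
move=> cM; elim: n => [|n IHn].
  move=> k f; exists k, idfun => u; split=> _; first by exists u.
  by apply/funext; case.
pose d (x : 'I_n.+1 -> M) : (M * ('I_n -> M))%type := (x ord0, x \o lift ord0).
have lin_d : linear d by [].
apply: (@coherent_mod_inj _ _ (mklin lin_d)); last exact: coherent_mod_prod.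
move=> x y [xy0 xy]; apply/funext => i; case: (unliftP ord0 i) => [j|] -> //.
exact: (congr1 (fun f => f j) xy).
Qed.

(** With [w] generating the kernel of [p] and [f'] lifting [f], the relations of [f] are the first
    halves of the relations of [f'] and [w] taken jointly in [A]. *)
Lemma coherent_mod_quot A M (p : {linear A -> M}) :
  surj p -> fg_pred (fun a => p a = 0) -> coherent_mod A -> coherent_mod M.
Proof.
move=> sp [k [w wP]] cA n f.
have [f' f'P] := free_lift (fun u => sp (f u)).
have [h hP] := row_pair_ex f' w.
have [m [z zP]] := cA _ h.
exists m, (lsubmx \o z) => u; split=> [fu|[v <-]].
  have /wP[v wv] : p (- f' u) = 0 by rewrite linearN f'P fu oppr0.
  have /zP[x zx] : h (row_mx u v) = 0 by rewrite hP wv subrr.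
  by exists x; rewrite /= zx [LHS]row_mxKl.
have /zP : exists x, z x = z v by exists v.
rewrite -[z v]hsubmxK hP => /eqP; rewrite addr_eq0 => /eqP e.
rewrite -f'P /= e linearN; apply/eqP; rewrite oppr_eq0; apply/eqP/wP.
by exists (rsubmx (z v)).
Qed.

Lemma coherent_ker A B (f : {linear A -> B}) :
  fin_gen A -> coherent_mod B -> fg_pred (fun a => f a = 0).
Proof.
move=> /fin_genP[n [p sp]] cB; have [m [z zP]] := cB _ (f \o p).
exists m, (p \o z) => a; split=> [fa|[v <-]].
  have [u pu] := sp a; have /zP[v zv] : (f \o p) u = 0 by rewrite /= pu.
  by exists v; rewrite /= zv.
by apply/zP; exists v.
Qed.

Lemma fin_gen_coherent M : fin_gen M -> coherent_mod M -> fin_pres M.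
Proof. by move=> /fin_genP[n [g sg]] cM; apply/fin_presP; exists n, g. Qed.

Lemma fg_pred_fin_gen K A (i : {linear K -> A}) :
  injective i -> fg_pred (fun a => exists k, i k = a) -> fin_gen K.
Proof.
move=> inj_i [n [g gP]];
  have [k kP] := factor_inj inj_i (fun u => (gP (g u)).2 (ex_intro _ u erefl)).
apply/fin_genP; exists n, k => x.
have /gP[u gu] : exists k, i k = i x by exists x.
by exists u; apply: inj_i; rewrite kP.
Qed.

Lemma fin_gen_fg_pred K A (i : {linear K -> A}) :
  fin_gen K -> fg_pred (fun a => exists k, i k = a).
Proof.
move=> /fin_genP[n [g sg]]; exists n, (i \o g) => a; split=> [[k <-]|[u <-]].
  by have [u <-] := sg k; exists u.
by exists (g u).
Qed.

Lemma fin_gen_row n : fin_gen 'rV[S]_n.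
Proof. by apply/fin_genP; exists n, idfun => u; exists u. Qed.

Lemma fin_gen_prod A B : fin_gen A -> fin_gen B -> fin_gen (A * B)%type.
Proof.
move=> /fin_genP[m [f sf]] /fin_genP[n [g sg]].
have lin_f : linear (fun u => (f u, 0 : B)).
  by move=> a x y; rewrite linearP; congr (_, _); rewrite /= scaler0 addr0.
have lin_g : linear (fun u => (0 : A, g u)).
  by move=> a x y; rewrite linearP; congr (_, _); rewrite /= scaler0 addr0.
have [h hP] := row_pair_ex (mklin lin_f) (mklin lin_g).
apply/fin_genP; exists (m + n)%N, h => -[a b].
have [u fu] := sf a; have [v gv] := sg b; exists (row_mx u v).
by rewrite hP /= /linear_fun fu gv; congr (_, _); rewrite /= ?addr0 ?add0r.
Qed.

Lemma fin_gen_power M n : fin_gen M -> fin_gen ('I_n -> M).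
Proof.
move=> fM; elim: n => [|n IHn].
  exists 0%N, (fun=> 0) => x; exists (fun=> 0); apply/funext; by case.
pose d (x : (M * ('I_n -> M))%type) (i : 'I_n.+1) : M :=
  if unlift ord0 i is Some j then x.2 j else x.1.
have lin_d : linear d by move=> a x y; apply/funext => i; rewrite /d !fctE;
  case: unlift.
apply: (@fin_gen_surj _ _ (mklin lin_d)); last exact: fin_gen_prod.
move=> x; exists (x ord0, x \o lift ord0); apply/funext => i.
by rewrite /= /linear_fun /d; case: unliftP => [j|] ->.
Qed.

(** For [S := R^c] this unfolds to [right_coherent R]; stated over [S], it serves both the base ring
    and [(endo V)^c]. *)
Definition left_coherent : Prop :=
  forall (I : lmodType S) (j : {linear I -> S^o}),
    injective j -> fin_gen I -> fin_pres I.

(** * Finitely presented modules over a coherent ring *)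

Section Coherent.
Hypothesis coh : left_coherent.

(** The image of [f] is a finitely generated ideal, hence finitely presented, so the kernel of the
    map onto it is finitely generated by [fin_pres_ker]. *)
Lemma coherent_regular : coherent_mod S^o.
Proof.
move=> n f; have [I [e [j [se inj_j je]]]] := image_ex f.
have fI : fin_pres I by exact: coh inj_j (fin_gen_surj se (fin_gen_row n)).
apply: fg_pred_ext (fin_pres_ker fI (fin_gen_row n) se) => u.
by rewrite -je; split=> [->|];
  rewrite ?linear0 // -{1}[0 in X in X -> _](linear0 j) => /inj_j.
Qed.

Lemma coherent_row n : coherent_mod 'rV[S]_n.
Proof.
pose d (u : 'rV[S]_n) (i : 'I_n) : S^o := u 0 i.
have lin_d : linear d by move=> a x y; apply/funext => i; rewrite /d !mxE.
apply: (@coherent_mod_inj _ _ (mklin lin_d));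
  last exact: coherent_mod_power coherent_regular.
by move=> x y xy; apply/rowP => i; exact: (congr1 (fun f => f i) xy).
Qed.

Lemma fin_pres_coherent M : fin_pres M -> coherent_mod M.
Proof.
by move=> /fin_presP[n [g [sg kg]]];
  exact: (coherent_mod_quot sg kg (coherent_row (n:=n))).
Qed.

Lemma fin_pres_power M n : fin_pres M -> fin_pres ('I_n -> M).
Proof.
move=> fM; apply: fin_gen_coherent; first exact/fin_gen_power/fin_pres_gen.
exact/coherent_mod_power/fin_pres_coherent.
Qed.

Lemma fin_pres_sub K A (i : {linear K -> A}) :
  injective i -> fin_gen K -> fin_pres A -> fin_pres K.
Proof.
move=> inj_i fK fA; apply: fin_gen_coherent => //.
exact: coherent_mod_inj inj_i (fin_pres_coherent fA).
Qed.

Lemma fin_pres_kernel K A B (i : {linear K -> A}) (f : {linear A -> B}) :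
  injective i -> exact_at i f -> fin_pres A -> fin_pres B -> fin_pres K.
Proof.
move=> inj_i eif fA fB; apply: (fin_pres_sub inj_i _ fA).
apply: fg_pred_fin_gen inj_i _.
exact: fg_pred_ext (coherent_ker f (fin_pres_gen fA) (fin_pres_coherent fB)).
Qed.

End Coherent.
End Finiteness.

(** * Powers and copowers *)

Section Powers.
Variable S : pzRingType.
Implicit Types (A B C D E I K M N V W X Y : lmodType S).

Lemma family_linear V X n (h : 'I_n -> {linear V -> X}) :
  linear (fun x : 'I_n -> V => \sum_i h i (x i)).
Proof.
move=> a x y; rewrite scaler_sumr -big_split; apply: eq_bigr => i _ /=.
by rewrite -linearP.
Qed.

Definition copairing V X n (h : 'I_n -> {linear V -> X}) :=
  mklin (family_linear h).

Lemma copairingE V X n (h : 'I_n -> {linear V -> X}) x :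
  copairing h x = \sum_i h i (x i).
Proof. by []. Qed.

Lemma tupling_linear V X n (h : 'I_n -> {linear X -> V}) :
  linear (fun x => h^~ x : 'I_n -> V).
Proof. by move=> a x y; apply/funext => i; rewrite linearP. Qed.

Definition tupling V X n (h : 'I_n -> {linear X -> V}) :=
  mklin (tupling_linear h).

Lemma tuplingE V X n (h : 'I_n -> {linear X -> V}) x i : tupling h x i = h i x.
Proof. by []. Qed.

Lemma proj_linear V n (i : 'I_n) : linear (fun x : 'I_n -> V => x i).
Proof. by []. Qed.

Definition power_proj V n (i : 'I_n) := mklin (@proj_linear V n i).

Lemma incl_linear V n (i : 'I_n) :
  linear (fun v : V => (fun j => if j == i then v else 0) : 'I_n -> V).
Proof.
move=> a x y; apply/funext => j.
by rewrite !fctE; case: ifP; rewrite // scaler0 addr0.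
Qed.

Definition power_incl V n (i : 'I_n) := mklin (@incl_linear V n i).

Lemma power_sum V n (x : 'I_n -> V) : x = \sum_i power_incl V i (x i).
Proof.
apply/funext => j; rewrite fct_sumE (bigD1 j) //= /linear_fun eqxx big1 ?addr0
  // => i ij.
by rewrite eq_sym (negPf ij).
Qed.

Lemma linear_powerE V X n (q : {linear ('I_n -> V) -> X}) x :
  q x = \sum_i q (power_incl V i (x i)).
Proof. by rewrite {1}[x]power_sum linear_sum. Qed.

(** Only the image of [h], the sum of the two images, is recorded; the later arguments ask for
    nothing else. *)
Lemma power_pair_ex V X m n (f : {linear ('I_m -> V) -> X})
  (g : {linear ('I_n -> V) -> X}) :
  exists h : {linear ('I_(m + n) -> V) -> X},
    (forall x y, exists z, h z = f x + g y) /\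
      (forall z, exists x y, h z = f x + g y).
Proof.
have lin_h : linear (fun z : 'I_(m + n) -> V =>
    f (z \o lshift n) + g (z \o @rshift m n)).
  move=> a x y; rewrite scalerDr addrACA.
  by congr (_ + _); rewrite -linearP.
exists (mklin lin_h); split=> [x y|z];
  last by exists (z \o lshift n), (z \o @rshift m n).
exists (fun i => match fintype.split i with inl j => x j | inr j => y j end).
by rewrite /= /linear_fun; congr (f _ + g _); apply/funext => i /=;
  [rewrite (unsplitK (inl _ i))|rewrite (unsplitK (inr _ i))].
Qed.

Lemma finType_finsupp (T : finType) V (x : T -> V) : x \in @finsupp S _ V.
Proof. by apply/asboolP; exact: finite_finset. Qed.

Lemma copower_of_linear (T : finType) V :
  linear (fun x : T -> V => Copower (finType_finsupp x)).
Proof. by move=> a x y; apply: val_inj. Qed.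

Definition copower_of (T : finType) V := mklin (@copower_of_linear T V).

Lemma copower_val_linear (T : Type) V : linear (@copower_val S T V).
Proof. by []. Qed.

Definition copower_fun (T : Type) V := mklin (@copower_val_linear T V).

Lemma copower_ofK (T : finType) V : cancel (@copower_of T V) (@copower_fun T V).
Proof. by []. Qed.

Lemma copower_funK (T : finType) V :
  cancel (@copower_fun T V) (@copower_of T V).
Proof. by move=> x; apply: val_inj. Qed.

(** Over a finite index set every family is finitely supported, so plain function modules can
    replace copowers. *)
Lemma addCl_summand V M : addCl V M <-> exists n, summand M ('I_n -> V).
Proof.
split=> [[n [i [p ip]]]|[n [i [p ip]]]]; exists n.
  by exists (@copower_fun _ _ \o i), (p \o @copower_of _ _) => x /=;
    rewrite copower_funK ip.
by exists (@copower_of _ _ \o i), (p \o @copower_fun _ _) => x /=;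
  rewrite copower_ofK ip.
Qed.

Lemma addCl_power V n : addCl V ('I_n -> V).
Proof. by apply/addCl_summand; exists n, idfun, idfun. Qed.

Lemma addCl_self V : addCl V V.
Proof.
apply/addCl_summand; exists 1%N, (power_incl V ord0), (power_proj V ord0) => v.
by rewrite /= /linear_fun eqxx.
Qed.

Lemma AddCl_power_addCl V M n : addCl V M -> AddCl V ('I_n -> M).
Proof.
move=> /addCl_summand[k [i [p ip]]]; exists ('I_n * 'I_k)%type.
have lin_i : linear (fun (x : 'I_n -> M) (t : 'I_n * 'I_k) => i (x t.1) t.2).
  by move=> a x y; apply/funext => t; rewrite linearP.
have lin_p : linear (fun (x : 'I_n * 'I_k -> V) j => p (fun l => x (j, l))).
  by move=> a x y; apply/funext => j; exact: (linearP p).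
exists (@copower_of _ _ \o mklin lin_i), (mklin lin_p \o @copower_fun _ _) => x.
apply/funext => j /=; rewrite /linear_fun /=.
exact: ip.
Qed.

Lemma AddCl_power V n : AddCl V ('I_n -> V).
Proof. exact/AddCl_power_addCl/addCl_self. Qed.

Lemma Gen_power V n M (f : {linear ('I_n -> V) -> M}) : surj f -> Gen V M.
Proof. by move=> sf; exists ('I_n -> V : lmodType S), f; split=> //;
  exact: AddCl_power. Qed.

Lemma copower_finite (T : choiceType) V (s : seq T) :
  exists (f : {linear ('I_(size s) -> V) -> copower T V})
    (g : {linear copower T V -> ('I_(size s) -> V)}),
    forall y : copower T V, (forall t, copower_val y t != 0 -> t \in s) ->
      f (g y) = y.
Proof.
(* The entry at [t] is read at the first occurrence of [t], so duplicates in [s] do no harm; outside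
   [s] the index is [size s], [insub] fails and the entry is 0. *)
pose d (x : 'I_(size s) -> V) t :=
  if insub (index t s) is Some k then x k else 0.
have dP x : d x \in @finsupp S _ V.
  apply/asboolP; apply: (@sub_finite_set _ _ [set` s]%classic);
    last exact: finite_seq.
  move=> t; rewrite /d /=; case: insubP => [k + _ _|];
    first by rewrite index_mem.
  by rewrite eqxx.
have lin_d : linear (fun x => Copower (dP x)).
  move=> a x y; apply/val_inj/funext => t /=; rewrite !fctE /= /d.
  by case: insub => // ; rewrite scaler0 addr0.
have lin_r : linear (fun (y : copower T V) (k : 'I_(size s)) =>
  copower_val y (tnth (in_tuple s) k)).
  by [].
exists (mklin lin_d), (mklin lin_r) => y ys; apply/val_inj/funext => t.
rewrite /= /linear_fun /= /d; case: insubP => [k ts kE|ts].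
  congr (copower_val y _).
  by rewrite (tnth_nth t) kE nth_index // -index_mem.
by apply/esym/eqP; apply: contraNT ts => /ys; rewrite index_mem.
Qed.

(** The finitely many generators of [K] have finite supports, and every element of the image of [k]
    vanishes outside their union. *)
Lemma copower_fin_gen (T : Type) V K (k : {linear K -> copower T V}) :
  fin_gen K ->
  exists n (f : {linear ('I_n -> V) -> copower T V})
    (g : {linear copower T V -> ('I_n -> V)}),
    forall x, f (g (k x)) = k x.
Proof.
move=> [n [x xP]].
(* The index type is bare; [{classic T}] equips it with the equality test that membership in a
   sequence requires. *)
have supp i : exists s : seq {classic T},
    [set t | copower_val (k (x i)) t != 0]%classic = [set` s]%classic.
  by apply/finite_seqP; case: (k (x i)) => y /= /asboolP.
have [s sP] := choice supp.
have [f [g fgP]] := copower_finite V (flatten [seq s i | i <- enum 'I_n]).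
exists _, f, g => y; have [a ->] := xP y.
rewrite !linear_sum; apply: eq_bigr => i _; rewrite !linearZ /=; congr (_ *: _).
apply: fgP => t ti; apply/flattenP; exists (s i); first by apply/mapP; exists i;
  rewrite ?mem_enum.
have : [set` s i]%classic t by rewrite -sP.
by [].
Qed.

End Powers.

(** * Lifting of maps out of [V], and generation of Hom(V, X) over the endomorphism ring *)

Section Homs.
Variable S : pzRingType.
Implicit Types (A B C D E I K M N V W X Y : lmodType S).

Definition lifts Y X A (q : {linear X -> A}) : Prop :=
  forall g : {linear Y -> A},
    exists h : {linear Y -> X}, forall y, q (h y) = g y.

Lemma lifts_power V X A (q : {linear X -> A}) n :
  lifts V q -> lifts ('I_n -> V) q.
Proof.
move=> lq g; have [h hP] := choice (fun i : 'I_n => lq (g \o power_incl V i)).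
exists (copairing h) => x; rewrite [RHS]linear_powerE copairingE linear_sum.
by apply: eq_bigr => i _; rewrite hP.
Qed.

Lemma lifts_addCl V X A (q : {linear X -> A}) Y :
  lifts V q -> addCl V Y -> lifts Y q.
Proof.
move=> lq /addCl_summand[n [i [p ip]]] g.
have [h hP] := lifts_power lq (g \o p).
by exists (h \o i) => y; rewrite hP /= ip.
Qed.

Definition hom_gen V X : Prop :=
  exists n (q : {linear ('I_n -> V) -> X}), lifts V q.

Lemma lhom_sumE V X n (h : 'I_n -> lhom V X) v :
  (\sum_i h i : lhom V X) v = \sum_i h i v.
Proof. by elim/big_ind2: _ => // f x g y <- <-. Qed.

Lemma post_linear V A B (f : {linear A -> B}) :
  linear (fun h : lhom V A => (f \o h) : lhom V B).
Proof. by move=> a g h; apply: lhomP => v; rewrite /= linearD. Qed.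

Definition post V A B (f : {linear A -> B}) := mklin (@post_linear V A B f).

Lemma postE V A B (f : {linear A -> B}) (h : lhom V A) v :
  (post V f h : lhom V B) v = f (h v).
Proof. by []. Qed.

(** Generators of Hom(V, X) are the restrictions of [q] to the coordinates of the power, and the
    coefficients of a map [g] are the coordinates of a lift of [g] along [q]. *)
Lemma fin_gen_homP V X :
  fin_gen (lhom V X : lmodType (endo V)^c) <-> hom_gen V X.
Proof.
split=> [[n [x xP]]|[n [q lq]]]; exists n.
  exists (copairing x) => g; have [a gE] := xP g.
  exists (tupling (a : 'I_n -> lhom V V)) => v.
  by rewrite copairingE gE lhom_sumE.
exists (fun i => (q \o power_incl V i) : lhom V X) => g; have [h hP] := lq g.
exists (fun i => (power_proj V i \o h) : lhom V V); apply: lhomP => v.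
by rewrite lhom_sumE -hP [LHS]linear_powerE.
Qed.

End Homs.

(** * Generators of [Hom (V, T)] *)

Section QuasiTilting.
Variables (S : pzRingType) (V : lmodType S).
Implicit Types (A B C D E I K M N W X Y T : lmodType S).

(** For [B] a summand of a copower, with inclusion [iB] and projection [pB], the kernel of [g \o pB]
    is the image of [iB \o f] plus the image of the idempotent [1 - iB \o pB]. Finitely many
    elements of each image come from a finite power of [V]. *)
Lemma Pres_finite T : Pres V T ->
  exists (J : Type) (q : {linear copower J V -> T}), surj q /\
    forall n (k : {linear 'rV[S]_n -> copower J V}), (forall u, q (k u) = 0) ->
      exists m (h : {linear ('I_m -> V) -> copower J V}),
        (forall x, q (h x) = 0) /\ forall u, exists x, h x = k u.
Proof.
move=> [A [B [f [g [[JA [iA [pA ipA]]] [J [iB [pB ipB]]] fg sg]]]]].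
exists J, (g \o pB); split=> [t|n k gk].
  by have [b <-] := sg t; exists (iB b); rewrite /= ipB.
have [a aP] := free_lift (f := pB \o k) (p := f) (fun u => (fg _).1 (gk u)).
have [m1 [s1 [r1 sr1]]] := copower_fin_gen (iA \o a) (fin_gen_row S n).
have [m2 [s2 [r2 sr2]]] := copower_fin_gen k (fin_gen_row S n).
have lin_e : linear (fun y => y - iB (pB y)).
  by move=> c x y; rewrite [pB _]linearP [iB _]linearP opprD addrACA scalerBr.
have [h [hP1 hP2]] := power_pair_ex (iB \o f \o pA \o s1) (mklin lin_e \o s2).
exists (m1 + m2)%N, h; split=> [z|u].
  have [x [y ->]] := hP2 z;
    rewrite /= /linear_fun linearD linearB !ipB subrr addr0.
  by apply/fg; exists (pA (s1 x)).
have [z zE] := hP1 (r1 (iA (a u))) (r2 (k u)).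
exists z; rewrite zE /= /linear_fun sr2 [s1 _]sr1 /= ipA aP /=.
by rewrite addrC subrK.
Qed.

Lemma hom_gen_Pres T : fin_gen V ->
  (forall D, Gen V D -> ext1_zero V D) -> fin_pres T -> Pres V T -> hom_gen V T.
Proof.
move=> fV extV fT /Pres_finite[J [q [sq kq]]].
have /fin_genP[n [e se]] := fin_pres_gen fT.
have [e' e'P] := free_lift (fun u => sq (e u)).
have [m0 [s0 [r0 sr0]]] := copower_fin_gen e' (fin_gen_row S n).
have sh : surj (q \o s0).
  by move=> t; have [u <-] := se t; exists (r0 (e' u)); rewrite /= sr0 e'P.
have [k [z zP]] := fin_pres_ker fT (fin_gen_power m0 fV) sh.
have [|l [phi [qphi phiP]]] := kq _ (s0 \o z).
  by move=> u; apply: (zP (z u)).2; exists u.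
(* One finite power, through [s] and [r], must capture both the images of the generators and the
   kernel elements given by [phi]. *)
have [t [tP1 tP2]] := power_pair_ex s0 phi.
have [m [s [r sr]]] := copower_fin_gen t (fin_gen_power (m0 + l) fV).
have sr0' x : s (r (s0 x)) = s0 x.
  by have [w wP] := tP1 x 0; rewrite linear0 addr0 in wP; rewrite -wP sr.
have srphi y : s (r (phi y)) = phi y.
  by have [w wP] := tP1 0 y; rewrite linear0 add0r in wP; rewrite -wP sr.
exists m, (q \o s) => g.
have [D [d [j [sd inj_j jd]]]] := image_ex (r \o phi).
have [C [c [jc sc]]] := cokernel_ex j.
(* [sigma] sends [q (s0 x)] to the class of [r (s0 x)] modulo [D]. It is well defined because the
   kernel of [q \o s0] is carried by [s0] into the image of [phi]. It will be a section of the map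
   [p] that [q \o s] induces on [C]. *)
have [|sigma sigmaP] := factor_surj (h := c \o r \o s0) sh.
  move=> x /zP[u <-]; have [y yE] := phiP u.
  by rewrite /= -[s0 (z u)]yE; apply/jc; exists (d y); rewrite jd.
have [|p pP] := factor_surj (h := q \o s) sc.
  move=> w /jc[x <-]; have [y <-] := sd x.
  by rewrite /= jd /= srphi.
have [g' g'P] := ext1_lift (extV D (Gen_power sd)) (And3 inj_j jc sc)
  (sigma \o g).
exists g' => v; rewrite -pP g'P /=.
have [x <-] := sh (g v).
by rewrite sigmaP pP /= sr0'.
Qed.

End QuasiTilting.

(** * Modules over a coherent ring *)

Section CoherentBase.
Variables (S : pzRingType) (V : lmodType S).
Implicit Types (A B C D E I K M N W X Y T : lmodType S).

Hypothesis cohS : left_coherent S.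
Hypothesis fpV : fin_pres V.

Lemma fin_pres_addCl M : addCl V M -> fin_pres M.
Proof.
move=> /addCl_summand[n [i [p ip]]].
apply: (fin_pres_sub cohS (can_inj ip)); last exact: fin_pres_power.
apply: (@fin_gen_surj _ ('I_n -> V) _ p).
  by move=> m; exists (i m).
exact/fin_gen_power/fin_pres_gen.
Qed.

(** A precover is tested against [V] itself and composed with the projection of a power onto it.
    Conversely, lifting of maps from [V] passes to finite powers and their summands. *)
Lemma precovering_hom_gen :
  precovering_in_fp (addCl V) <-> forall X, fin_pres X -> hom_gen V X.
Proof.
split=> [[_ pc] A /pc[X [f [/addCl_summand[n [i [p ip]]] lf]]]|hg].
  exists n, (f \o p) => g; have [h hP] := lf V (addCl_self V) g.
  by exists (i \o h) => v; rewrite /= ip.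
split=> [M|A /hg[n [q lq]]]; first exact: fin_pres_addCl.
exists ('I_n -> V : lmodType S), q; split; first exact: addCl_power.
by move=> Y VY; exact: lifts_addCl.
Qed.

Lemma Gen_perp0 A B (f : {linear A -> B}) :
  Gen V A -> perp V B -> forall x, f x = 0.
Proof.
move=> [C [e [[J [i [p ip]]] se]]] pB x.
have [c <-] := se x; rewrite -[c]ip.
(* The single element [i c] is viewed as a map from the free module of rank one, which places it in
   a finite power of [V]. *)
have lin_row : linear (fun a : 'rV[S]_1 => a 0 0 *: i c).
  by move=> a y z; rewrite !mxE scalerDl scalerA.
have [n [s [r sr]]] := copower_fin_gen (mklin lin_row) (fin_gen_row S 1).
have <- : s (r (i c)) = i c.
  by have := sr (const_mx 1); rewrite /= /linear_fun mxE scale1r.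
rewrite [s _]linear_powerE !linear_sum big1 // => k _.
exact: (pB (f \o e \o p \o s \o power_incl V k)).
Qed.

Lemma restricts_hom_gen :
  (forall M, Gen V M -> Pres V M) -> (forall M, Gen V M -> ext1_zero V M) ->
  restricts_to_fp (Gen V) (perp V) <-> forall X, fin_pres X -> hom_gen V X.
Proof.
move=> gp ge; split=> [[_ _ _ tp] X /tp|hg].
  move=> [A [B [i [p [[GA fA] [pB fB] [inj_i eip _]]]]]].
  have [n [q lq]] := hom_gen_Pres (fin_pres_gen fpV) ge fA (gp A GA).
  (* Since [B] is torsion-free, [g] factors through the torsion part [A], where [q] lifts it. *)
  exists n, (i \o q) => g.
  have [g' g'P] := factor_inj (h := g) inj_i
    (fun v => (eip (g v)).1 (pB (p \o g) v)).
  by have [h hP] := lq g'; exists h => v; rewrite /= hP.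
split=> [M []|M []|A B f [GA _] [pB _]|M fM] //; first exact: Gen_perp0.
have [n [q lq]] := hg M fM.
have [T [e [j [se inj_j je]]]] := image_ex q.
have [F [c [jc sc]]] := cokernel_ex j.
have fW : fin_gen ('I_n -> V) by exact/fin_gen_power/fin_pres_gen.
have fT := fin_gen_surj se fW.
have GT := Gen_power se.
exists T, F, j, c; split; last by split.
  by split=> //; exact: (fin_pres_sub cohS inj_j).
split.
  (* A map from [V] to the quotient lifts to [M] because Ext vanishes on [T]; the lift factors
     through [q], so it lands in [T] and becomes zero in [F]. *)
  move=> g v; have [h hP] := ext1_lift (ge T GT) (And3 inj_j jc sc) g.
  by have [k kP] := lq h; rewrite -hP -kP; apply/jc; exists (e (k v));
    rewrite je.
apply: fin_pres_quot fM sc _.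
by apply: fg_pred_ext (fin_gen_fg_pred j fT) => x; rewrite jc.
Qed.

(** * The modules Hom(V, X) over the endomorphism ring, and coherence of that ring *)

Lemma fin_pres_hom_power n :
  fin_pres (lhom V ('I_n -> V) : lmodType (endo V)^c).
Proof.
pose d (u : 'rV[(endo V)^c]_n) : lhom V ('I_n -> V) :=
  tupling (fun i => (u 0 i : lhom V V) : {linear V -> V}).
have lin_d : linear d.
  by move=> a x y; apply: lhomP => v; apply/funext => i; rewrite !tuplingE !mxE.
apply/fin_presP; exists n, (mklin lin_d); split.
  move=> h; exists (\row_i ((power_proj V i \o h) : lhom V V)).
  by apply: lhomP => v; apply/funext => i; rewrite tuplingE mxE.
(* [d] is injective as well, so the module is free of rank [n] and the relations have rank 0. *)
exists 0%N, (\0 : {linear 'rV_0 -> 'rV_n}) => u; split=> [du|[w <-]];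
  last by rewrite linear0.
exists 0; apply/rowP => i; rewrite mxE; apply: lhomP => v.
by have /(congr1 (fun h : lhom V ('I_n -> V) => h v i)) := du.
Qed.

Lemma post_inj A B (f : {linear A -> B}) : injective f -> injective (post V f).
Proof.
move=> inj_f g h gh; apply: lhomP => v; apply: inj_f.
by rewrite -!postE gh.
Qed.

Lemma post_exact A B C (f : {linear A -> B}) (g : {linear B -> C}) :
  injective f -> exact_at f g -> exact_at (post V f) (post V g).
Proof.
move=> inj_f fg h; split=> [gh|[k <-]].
  have [|k kP] := factor_inj (h := h : {linear V -> B}) inj_f.
    by move=> v; apply/fg; rewrite -postE gh.
  by exists k; apply: lhomP => v; rewrite postE kP.
by apply: lhomP => v; rewrite !postE; apply/fg; exists (k v).
Qed.

(** Let [q] from a power of [V] generate Hom(V, X), and let [K] be its kernel, finitely presented by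
    coherence. Composition with [q] maps a free module onto Hom(V, X) with kernel Hom(V, K), and the
    hypothesis applied to [K] makes that kernel finitely generated. *)
Lemma hom_gen_fin_pres :
  (forall X, fin_pres X -> hom_gen V X) <->
  (forall X, fin_pres X -> fin_pres (lhom V X : lmodType (endo V)^c)).
Proof.
split=> hg X fX; last exact/fin_gen_homP/fin_pres_gen/hg.
have [n [q lq]] := hg X fX.
have [K [i [inj_i iq]]] := kernel_ex q.
have fK : fin_pres K.
  by apply: (fin_pres_kernel cohS inj_i iq) => //; exact: fin_pres_power.
apply: (fin_pres_quot (g := post V q) (fin_pres_hom_power n)).
  by move=> g; have [h hP] := lq g; exists h; apply: lhomP.
have /fin_gen_homP fHK := hg K fK.
by apply: fg_pred_ext (fin_gen_fg_pred (post V i) fHK) => h;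
  rewrite (post_exact inj_i iq).
Qed.

(** The generators of the right ideal assemble into [f] from a power of [V] to [V]. The ideal is
    then the image of composition with [f], and the kernel of that composition is Hom(V, K) with [K]
    the finitely presented kernel of [f]. *)
Lemma endo_coherent :
  (forall X, fin_pres X -> fin_pres (lhom V X : lmodType (endo V)^c)) ->
  left_coherent (endo V)^c.
Proof.
move=> fpH I j inj_j [n [x xP]].
pose f := copairing (fun i => (j (x i) : lhom V V) : {linear V -> V}).
(* Precomposition on Hom(V, V) agrees with the regular action, so the identity identifies the two
   modules. *)
have lin_id : linear (fun h : lhom V V => h : ((endo V)^c)^o) by [].
have fE (h : lhom V ('I_n -> V)) :
    mklin lin_id (post V f h) = j
      (\sum_i (((power_proj V i \o h) : lhom V V) : (endo V)^c) *: x i).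
  rewrite linear_sum; apply: lhomP => v; rewrite lhom_sumE.
  by apply: eq_bigr => i _; rewrite linearZ.
have [|p pP] := factor_inj (h := mklin lin_id \o post V f) inj_j.
  by move=> h; eexists; exact: esym (fE h).
have [K [i [inj_i ii]]] := kernel_ex f.
have fK : fin_pres K.
  by apply: (fin_pres_kernel cohS inj_i ii) => //; exact: fin_pres_power.
apply: (fin_pres_quot (g := p) (fin_pres_hom_power n)).
  move=> y; have [a ->] := xP y.
  exists (tupling (fun i => (a i : lhom V V) : {linear V -> V})).
  apply: inj_j; rewrite pP [LHS]fE; congr (j _); apply: eq_bigr => k _.
  by congr (_ *: _); apply: lhomP.
apply: fg_pred_ext (fin_gen_fg_pred (post V i) (fin_pres_gen (fpH K fK))) => h.
rewrite -(post_exact inj_i ii); split=> [fh|ph].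
  by apply: inj_j; rewrite pP linear0 /= fh.
by have := pP h; rewrite ph linear0.
Qed.

Lemma hom_gen_endo_coherent (V0 V1 : lmodType S)
    (f0 : {linear S^o -> V0}) (g0 : {linear V0 -> V1}) :
  (forall M, Gen V M -> Pres V M) -> (forall M, Gen V M -> ext1_zero V M) ->
  addCl V V0 -> addCl V V1 -> injective f0 -> exact_at f0 g0 ->
  left_coherent (endo V)^c ->
  forall X, fin_pres X -> hom_gen V X.
Proof.
move=> gp ge V0V /addCl_summand[l [i1 [p1 ip1]]] inj_f0 fg0 cohE X
  /fin_presP[n [p [sp [m [z zP]]]]].
have lin_F : linear (fun (u : 'rV[S]_n) (i : 'I_n) => f0 (u 0 i)).
  by move=> a x y; apply/funext => i; rewrite !mxE linearP.
pose F := mklin lin_F.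
have inj_F : injective F.
  by move=> u v uv; apply/rowP => i; apply: inj_f0;
    exact: (congr1 (fun h => h i) uv).
have lin_G : linear (fun (x : 'I_n -> V0) (i : 'I_n) => g0 (x i)).
  by move=> a x y; apply/funext => i; rewrite linearP.
pose G := mklin lin_G.
have eFG : exact_at F G.
  move=> x; split=> [Gx|[u <-]].
    have xi i : exists a, f0 a = x i by apply/fg0;
      exact: (congr1 (fun h => h i) Gx).
    have [a aP] := choice xi; exists (\row_i a i); apply/funext => i.
    by rewrite /= /linear_fun mxE.
  by apply/funext => i; apply/fg0; exists (u 0 i).
(* The pushout of [F] along [p] is taken as the cokernel of [F] on the relations of [X]; this
   exhibits it as a finitely presented quotient of a power of [V0]. *)
have [X' [c [Fzc sc]]] := cokernel_ex (F \o z).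
have fX' : fin_pres X'.
  apply: (fin_pres_quot (g := c)) => //; last by exists m, (F \o z).
  exact/(fin_pres_power cohS)/fin_pres_addCl.
have GX' : Gen V X' by exists ('I_n -> V0 : lmodType S), c; split=> //;
  exact: AddCl_power_addCl.
have /fin_gen_homP fHX' := hom_gen_Pres (fin_pres_gen fpV) ge fX' (gp X' GX').
have [|d dP] := factor_surj (h := G) sc.
  by move=> x /Fzc[u <-]; apply/eFG; exists (z u).
have [|i iP] := factor_surj (h := c \o F) sp.
  by move=> u /zP[v <-]; apply/Fzc; exists v.
(* If [F u] dies in [X'], it equals some [F (z v)], so [u] is a relation by injectivity of [F]. *)
have inj_i : injective i.
  apply: raddf_inj => x; have [u <-] := sp x;
    rewrite [X in X = _]iP => /Fzc[v /= /inj_F <-].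
  by apply/zP; exists v.
have eid : exact_at i d.
  move=> x'; split=> [|[x <-]].
    have [y <-] := sc x'; rewrite dP => /eFG[u <-].
    by exists (p u); rewrite iP.
  by have [u <-] := sp x; rewrite iP /= dP; apply/eFG; exists u.
apply/fin_gen_homP; apply: (fg_pred_fin_gen (post_inj inj_i)).
apply: (@fg_pred_ext _ _ (fun h => post V d h = 0)) => [h|];
  first exact: post_exact.
apply: coherent_ker => //.
(* Through the inclusion [i1] of [V1] in a power of [V], coordinates embed Hom(V, V1^n) into a
   finite power of the regular module, from which it inherits coherence. *)
pose e (h : lhom V ('I_n -> V1)) (k : 'I_n) (k' : 'I_l) : ((endo V)^c)^o :=
  (power_proj V k' \o (i1 \o (power_proj V1 k \o h))) : lhom V V.
have lin_e : linear e.
  move=> a x y; apply/funext => k; apply/funext => k'; apply: lhomP => v.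
  by rewrite /e /= /linear_fun /= !linearD.
apply: (@coherent_mod_inj _ _ _ (mklin lin_e)); last first.
  exact/coherent_mod_power/coherent_mod_power/coherent_regular.
move=> g h gh; apply: lhomP => v; apply/funext => k; apply: (can_inj ip1);
  apply/funext => k'.
by have := congr1 (fun w : 'I_n -> 'I_l -> lhom V V => w k k' v) gh.
Qed.

End CoherentBase.

Theorem corollary6p7 (R : pzRingType) (V : rmodType R)
    (cohR : right_coherent R) (fpV : fin_pres V) (qtV : quasi_tilting V) :
  let a1 := restricts_to_fp (Gen V) (perp V) in
  let a2 := precovering_in_fp (addCl V) in
  let a3 := forall X : rmodType R, fin_pres X ->
              fin_pres (lhom V X : rmodType (endo V)) in
  let a4 := right_coherent (endo V) in
  [/\ a1 <-> a2,
      a2 <-> a3,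
      finendo V -> a3 -> a4
    & classical_tilting V -> [/\ a1 <-> a2, a2 <-> a3 & a3 <-> a4]].
Proof.
move=> a1 a2 a3 a4; case: qtV => _ gp ge.
have gp' M : Gen V M -> Pres V M by move/gp.
have ge' M : Gen V M -> ext1_zero V M by case/ge.
have e1 := restricts_hom_gen cohR fpV gp' ge'.
have e2 := precovering_hom_gen cohR fpV.
have e3 := hom_gen_fin_pres cohR fpV.
have e12 : a1 <-> a2 by apply: iff_trans e1 (iff_sym e2).
have e23 : a2 <-> a3 by apply: iff_trans e2 e3.
have e34 : a3 -> a4 := endo_coherent cohR fpV.
split=> // -[_ _ [V0 [V1 [f [g [VV0 VV1 [inj_f fg _]]]]]]].
split=> //; split=> // cohE; apply/e3.
exact: (hom_gen_endo_coherent cohR fpV gp' ge' VV0 VV1 inj_f fg cohE).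
Qed.
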